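(* Let $H$ be a real separable Hilbert space and let $A\in\mathcal L(H^2)$ be selfadjoint, nonnegative and trace class in $H^2$. Let $q_A(X,Y)=(AX)\cdot Y$ and $Q_A(X)=(AX)\cdot X$. Let $B_A$ be the Hilbert space obtained by completing $H^2/\mathrm{Ker}\,A$ for the norm $Q_A^{1/2}$, and let $\mathcal F:(x,\xi)\mapsto(-\xi,x)$ on $H^2$. Then $\mathcal F A$, defined in $H^2/\mathrm{Ker}\,A$, extends to a trace class operator in $B_A$, which is skew symmetric for $q_A$.
   Context: $X\cdot Y$ denotes the natural scalar product of $H^2$. The form $q_A$ induces a scalar product on $H^2/\mathrm{Ker}\,A$, which extends to $B_A$ and is still denoted $q_A$. The operator $\mathcal F A$ on $H^2/\mathrm{Ker}\,A$ is the map $X+\mathrm{Ker}\,A\mapsto \mathcal F A X+\mathrm{Ker}\,A$. Skew symmetric for $q_A$ means $q_A(TX,Y)=-q_A(X,TY)$. *)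

(* Defs.v *)
From HB Require Import structures.
From mathcomp Require Import all_boot all_order all_algebra generic_quotient.
From mathcomp Require Import ring_quotient sesquilinear.
From mathcomp Require Import all_classical all_reals.
From mathcomp Require Import topology normedtype esum.
From mathcomp Require Import ring lra.

Set Implicit Arguments.
Unset Strict Implicit.
Unset Printing Implicit Defensive.

Import Order.TTheory GRing.Theory Num.Theory.
Import numFieldNormedType.Exports.

Local Open Scope classical_set_scope.
Local Open Scope ring_scope.
Local Open Scope quotient_scope.

HB.mixin Record isHilbert (R : realType) V of NormedModule R V := {
  dotp : {dot V for (idfun : R -> R)};
  dotp_norm : forall x : V, dotp x x = `|x| ^+ 2
}.

#[short(type="hilbertType")]
HB.structure Definition Hilbert (R : realType) :=
  {V of CompleteNormedModule R V & isHilbert R V}.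

Section DotTheory.
Context {R : realType} {V : hilbertType R}.
Implicit Types (x y z : V) (a : R).

Lemma dotpC x y : dotp x y = dotp y x.
Proof. by rewrite (hermC (dotp (s := V))) expr0 mul1r. Qed.

Lemma dotpDr x y z : dotp x (y + z) = dotp x y + dotp x z.
Proof. exact: linearDr. Qed.

Lemma dotpZr a x y : dotp x (a *: y) = a * dotp x y.
Proof. by rewrite linearZr_LR. Qed.

Lemma dotpDl x y z : dotp (x + y) z = dotp x z + dotp y z.
Proof. by rewrite dotpC dotpDr !(dotpC z). Qed.

Lemma dotpZl a x y : dotp (a *: x) y = a * dotp x y.
Proof. by rewrite dotpC dotpZr dotpC. Qed.

End DotTheory.

Definition separable (T : topologicalType) :=
  exists2 D : set T, countable D & dense D.

(* An alias of [V * W], whose canonical norm in the library is the max norm. *)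
Definition hsum (V W : Type) : Type := (V * W)%type.

Section HilbertSum.
Context {R : realType} (V W : hilbertType R).

HB.instance Definition _ := GRing.Lmodule.copy (hsum V W) (V * W)%type.

Definition hsum_dot (x y : hsum V W) : R := dotp x.1 y.1 + dotp x.2 y.2.

Lemma hsum_dot_bilinear :
  bilinear_for ( *%R : GRing.Scale.law R R)
    ((idfun : R -> R) \; *%R : GRing.Scale.law R R) hsum_dot.
Proof.
split=> [u' a u v | u a u' v].
  by rewrite /hsum_dot /= !dotpDl !dotpZl mulrDr addrACA.
by rewrite /hsum_dot /= !dotpDr !dotpZr mulrDr addrACA.
Qed.

HB.instance Definition _ := bilinear_isBilinear.Build R (hsum V W) (hsum V W) R
  *%R ((idfun : R -> R) \; *%R) hsum_dot hsum_dot_bilinear.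

Lemma hsum_dot_hermitian (x y : hsum V W) :
  hsum_dot x y = (-1) ^+ false * (idfun : R -> R) (hsum_dot y x).
Proof. by rewrite expr0 mul1r /hsum_dot /= !(dotpC y.1, dotpC y.2). Qed.

HB.instance Definition _ := isHermitianSesquilinear.Build R (hsum V W)
  false idfun hsum_dot hsum_dot_hermitian.

Lemma hsum_dot_gt0 (x : hsum V W) : x != 0 -> 0 < hsum_dot x x.
Proof.
case: x => x y; rewrite /hsum_dot /= !dotp_norm => xy0.
rewrite lt_def addr_ge0 ?exprn_ge0// andbT paddr_eq0 ?exprn_ge0//.
by rewrite !sqrf_eq0 !normr_eq0.
Qed.

HB.instance Definition _ := isDotProduct.Build R (hsum V W) hsum_dot hsum_dot_gt0.

Definition hsum_norm (x : hsum V W) : R := Num.sqrt (hsum_dot x x).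

Let hsum_dot_ge0 (x : hsum V W) : 0 <= hsum_dot x x.
Proof. by rewrite /hsum_dot !dotp_norm addr_ge0 ?exprn_ge0. Qed.

Let hsum_norm2 (x : hsum V W) : hsum_norm x ^+ 2 = `|x.1| ^+ 2 + `|x.2| ^+ 2.
Proof. by rewrite sqr_sqrtr// /hsum_dot !dotp_norm. Qed.

Lemma ler_hsum_normD (x y : hsum V W) :
  hsum_norm (x + y) <= hsum_norm x + hsum_norm y.
Proof.
have n0 z : 0 <= hsum_norm z by exact: sqrtr_ge0.
rewrite -ler_sqr ?nnegrE ?addr_ge0// sqrrD !hsum_norm2.
have le1 : `|(x + y).1| ^+ 2 <= (`|x.1| + `|y.1|) ^+ 2.
  by rewrite ler_sqr ?nnegrE ?addr_ge0// ler_normD.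
have le2 : `|(x + y).2| ^+ 2 <= (`|x.2| + `|y.2|) ^+ 2.
  by rewrite ler_sqr ?nnegrE ?addr_ge0// ler_normD.
apply: (le_trans (lerD le1 le2)).
have cs : `|x.1| * `|y.1| + `|x.2| * `|y.2| <= hsum_norm x * hsum_norm y.
  rewrite -ler_sqr ?nnegrE ?addr_ge0 ?mulr_ge0 ?normr_ge0//.
  rewrite [leRHS]exprMn !hsum_norm2.
  set a := `|x.1|; set b := `|x.2|; set c := `|y.1|; set d := `|y.2|.
  rewrite -subr_ge0 (_ : _ - _ = (a * d - b * c) ^+ 2) ?sqr_ge0//.
  by ring.
by move: cs; rewrite !sqrrD; set p := _ * hsum_norm y => cs; lra.
Qed.

Lemma hsum_normZ (a : R) (x : hsum V W) : hsum_norm (a *: x) = `|a| * hsum_norm x.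
Proof.
rewrite /hsum_norm /hsum_dot /= !dotpZl !dotpZr !mulrA -mulrDr -expr2.
by rewrite sqrtrM ?sqr_ge0// sqrtr_sqr.
Qed.

Lemma hsum_norm0_eq0 (x : hsum V W) : hsum_norm x = 0 -> x = 0.
Proof.
move=> /eqP; rewrite sqrtr_eq0; apply: contraTeq => /hsum_dot_gt0.
by rewrite ltNge.
Qed.

HB.instance Definition _ := Lmodule_isNormed.Build R (hsum V W)
  ler_hsum_normD hsum_normZ hsum_norm0_eq0.

Lemma hsum_complete (F : set_system (hsum V W)) :
  ProperFilter F -> cauchy F -> cvg F.
Proof.
move=> FF /(@cauchyP R) Fc.
have le1 (x : hsum V W) : `|x.1| <= `|x|.
  by rewrite -ler_sqr ?nnegrE// hsum_norm2 lerDl sqr_ge0.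
have le2 (x : hsum V W) : `|x.2| <= `|x|.
  by rewrite -ler_sqr ?nnegrE// hsum_norm2 lerDr sqr_ge0.
have le12 (x : hsum V W) : `|x| <= `|x.1| + `|x.2|.
  rewrite -ler_sqr ?nnegrE ?addr_ge0// hsum_norm2 sqrrD addrAC lerDl.
  by rewrite mulrn_wge0 ?mulr_ge0.
have c1 : cvg ((fun x : hsum V W => x.1) @ F).
  apply: cauchy_cvg; apply/(@cauchyP R) => e /Fc[x Fx].
  exists x.1; apply: (@filterS _ F _ _ _ _ Fx) => y /=.
  by rewrite -!ball_normE /= => /(le_lt_trans _); apply; exact: (le1 (x - y)).
have c2 : cvg ((fun x : hsum V W => x.2) @ F).
  apply: cauchy_cvg; apply/(@cauchyP R) => e /Fc[x Fx].
  exists x.2; apply: (@filterS _ F _ _ _ _ Fx) => y /=.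
  by rewrite -!ball_normE /= => /(le_lt_trans _); apply; exact: (le2 (x - y)).
move/cvg_ex: c1 => [l1 /cvgrPdist_lt c1].
move/cvg_ex: c2 => [l2 /cvgrPdist_lt c2].
apply/cvg_ex; exists ((l1, l2) : hsum V W); apply/cvgrPdist_lt => e e0.
have e20 : 0 < e / 2 by rewrite divr_gt0.
near=> x; apply: (le_lt_trans (le12 _)); rewrite [ltRHS]splitr ltrD//=.
- by near: x; exact: c1.
- by near: x; exact: c2.
Unshelve. all: by end_near. Qed.

HB.instance Definition _ := Uniform_isComplete.Build (hsum V W) hsum_complete.

Lemma hsum_dot_norm (x : hsum V W) : hsum_dot x x = `|x| ^+ 2.
Proof. by rewrite sqr_sqrtr. Qed.

HB.instance Definition _ := isHilbert.Build R (hsum V W) hsum_dot_norm.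

Lemma hsum_dotpE (x y : hsum V W) : dotp x y = dotp x.1 y.1 + dotp x.2 y.2.
Proof. by []. Qed.

End HilbertSum.

Section Operators.
Context {R : realType} {V : hilbertType R}.
Implicit Types S T P : {linear V -> V}.

Definition is_adjoint T S := forall x y, dotp (T x) y = dotp x (S y).

Definition selfadjoint T := is_adjoint T T.

Definition nonnegative T := forall x, 0 <= dotp (T x) x.

Definition skew_symmetric T := forall x y, dotp (T x) y = - dotp x (T y).

Definition is_absolute_value T P :=
  [/\ continuous P, selfadjoint P, nonnegative P &
    exists2 S : {linear V -> V}, is_adjoint T S & forall x, P (P x) = S (T x)].

Definition orthonormal_basis (E : set V) :=
  [/\ forall e, E e -> dotp e e = 1,
      forall e f, E e -> E f -> e <> f -> dotp e f = 0 &
      forall x, (forall e, E e -> dotp x e = 0) -> x = 0].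

(* [Tr |T|] is the sum of the [dotp (|T| e) e] over an orthonormal basis; |T|
   is unique, and the sum of these nonnegative terms does not depend on the
   basis. *)
Definition trace_class T := continuous T /\
  exists P (E : set V), [/\ is_absolute_value T P, orthonormal_basis E &
    (\esum_(e in E) (dotp (P e) e)%:E < +oo)%E].

End Operators.

Section KernelQuotient.
Context {R : realType} {V : lmodType R} (f : {linear V -> V}).

Definition kernel : {pred V} := [pred x | f x == 0].

Lemma kernel_zmod_closed : zmod_closed kernel.
Proof.
split=> [|x y]; first by rewrite inE linear0.
by rewrite !inE linearB => /eqP-> /eqP->; rewrite subrr.
Qed.

HB.instance Definition _ := GRing.isZmodClosed.Build V kernel kernel_zmod_closed.

Definition quot_ker := Quotient.quot kernel.

HB.instance Definition _ := GRing.Zmodule.on quot_ker.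
HB.instance Definition _ := EqQuotient.on quot_ker.

Definition coset_ker (x : V) : quot_ker := \pi x.

Lemma coset_kerP x y : coset_ker x = coset_ker y <-> f (x - y) = 0.
Proof.
rewrite /coset_ker; split=> [/eqP|fxy]; first by rewrite -Quotient.idealrBE inE => /eqP.
by apply/eqP; rewrite -Quotient.idealrBE inE fxy.
Qed.

Lemma repr_coset_ker x : f (repr (coset_ker x)) = f x.
Proof.
by apply/eqP; rewrite -subr_eq0 -linearB; apply/eqP/coset_kerP; exact: reprK.
Qed.

Lemma coset_kerK (u : quot_ker) : coset_ker (repr u) = u.
Proof. exact: reprK. Qed.

Lemma coset_kerB : {morph coset_ker : x y / x - y}.
Proof. by move=> x y; rewrite /coset_ker !piE. Qed.

Lemma coset_kerD : {morph coset_ker : x y / x + y}.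
Proof. by move=> x y; rewrite /coset_ker !piE. Qed.

Definition quot_scale (a : R) (u : quot_ker) : quot_ker :=
  coset_ker (a *: repr u).

Lemma coset_kerZ a x : coset_ker (a *: x) = quot_scale a (coset_ker x).
Proof.
by apply/coset_kerP; rewrite linearB 2!linearZ repr_coset_ker subrr.
Qed.

Fact quot_scaleA a b u : quot_scale a (quot_scale b u) = quot_scale (a * b) u.
Proof. by rewrite -(coset_kerK u) -!coset_kerZ scalerA. Qed.

Fact quot_scale1 : left_id 1 quot_scale.
Proof. by move=> u; rewrite -(coset_kerK u) -coset_kerZ scale1r. Qed.

Fact quot_scaleDr : right_distributive quot_scale +%R.
Proof.
move=> a u v; rewrite -(coset_kerK u) -(coset_kerK v).
by rewrite -coset_kerD -!coset_kerZ -coset_kerD scalerDr.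
Qed.

Fact quot_scaleDl u : {morph quot_scale^~ u : a b / a + b}.
Proof.
move=> a b; rewrite -(coset_kerK u) -!coset_kerZ.
by rewrite -coset_kerD scalerDl.
Qed.

HB.instance Definition _ := GRing.Zmodule_isLmodule.Build R quot_ker
  quot_scaleA quot_scale1 quot_scaleDr quot_scaleDl.

HB.instance Definition _ :=
  GRing.isZmodMorphism.Build V quot_ker coset_ker coset_kerB.
HB.instance Definition _ :=
  GRing.isScalable.Build R V quot_ker *:%R coset_ker coset_kerZ.

End KernelQuotient.

Section FormSpace.
Context {R : realType} {V : hilbertType R} (A : {linear V -> V}).

Definition qform (X Y : V) : R := dotp (A X) Y.

Definition quot_qform (u v : quot_ker A) : R := qform (repr u) (repr v).

Lemma quot_qformE X Y : selfadjoint A ->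
  quot_qform (coset_ker A X) (coset_ker A Y) = qform X Y.
Proof.
by move=> sA; rewrite /quot_qform /qform repr_coset_ker !(sA X) repr_coset_ker.
Qed.

(* [(B, j)] is the completion, unique up to a unique isometric isomorphism, of
   the quotient by the kernel of [A] for the scalar product induced by [qform];
   [dotp] on [B] is then the extension of that scalar product. *)
Definition is_completion (B : hilbertType R) (j : {linear quot_ker A -> B}) :=
  (forall u v, dotp (j u) (j v) = quot_qform u v) /\ dense (range j).

(* The map [X + Ker A |-> S A X + Ker A], which does not depend on the
   representative [X]. *)
Definition quot_comp (S : V -> V) (u : quot_ker A) : quot_ker A :=
  coset_ker A (S (A (repr u))).

Lemma quot_compE S X :
  quot_comp S (coset_ker A X) = coset_ker A (S (A X)).
Proof. by rewrite /quot_comp repr_coset_ker. Qed.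

End FormSpace.

Definition symplectic_map {R : realType} {H : hilbertType R} (X : hsum H H) :
  hsum H H := (- X.2, X.1).

(* Main.v *)
Require Import Defs.
From HB Require Import structures.
From mathcomp Require Import all_boot all_order all_algebra finmap.
From mathcomp Require Import all_classical all_reals.
From mathcomp Require Import topology ereal normedtype esum.
From mathcomp Require Import ring lra.

(** The canonical map [i : X |-> j (X + Ker A)] from [V = H^2] to [B] satisfies
   [dotp (i X) (i Y) = dotp (A X) Y].  Hence it is bounded, its adjoint [i']
   satisfies [i' (i X) = A X], and for [F] the symplectic map the operator
   [T = i F i'] extends [F A] since [T (i X) = i (F (A X))].  It is skew
   symmetric because [F] is.

   The map [i] is Hilbert-Schmidt, since the sum of the [`|i e| ^+ 2] over an
   orthonormal basis is the trace of [A].  So [T] is the product of the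
   Hilbert-Schmidt operators [F i'] and [i], and such a product is trace class
   ([trace_class_comp]).

   Three facts carry this out.
   - The Riesz representation theorem, for a functional defined on an arbitrary
     subspace ([riesz_graph]), gives adjoints, Parseval's inequality, and the
     Douglas factorisation [douglas]: if [`|g x| <= `|f x|] for all [x], then
     [g = U f] for a contraction [U].  As [T] and its absolute value [P] have
     the same pointwise norms, there are contractions [U] with [P = U T] and [U]
     with [T = U P], which serve as the polar decomposition.
   - By the inequalities of Bessel and Parseval, the Hilbert-Schmidt sum of
     [L'] is at most that of [L] ([hilbert_schmidt_adjoint]); so finiteness of
     this sum does not depend on the basis and passes to adjoints.
   - Every bounded nonnegative selfadjoint operator has a square root of the
     same kind ([positive_sqrt_exists]), whence absolute values exist.

   The polar decomposition is used in both directions.  For a product [L K] of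
   Hilbert-Schmidt operators with absolute value [P = U L K], each
   [dotp (P e) e] equals [dotp (K e) ((U L)' e)], a product of two square
   summable factors.  Conversely, trace class is a condition on the absolute
   value of [A] and not on [A]; that the trace of [A] itself is finite follows
   from [A = U S S], with [S] the square root of the absolute value
   ([trace_class_esum_lty]). *)

Import Order.TTheory GRing.Theory Num.Theory.
Import numFieldNormedType.Exports.

Set Implicit Arguments.
Unset Strict Implicit.
Unset Printing Implicit Defensive.

Local Open Scope ring_scope.

(** * Inner products *)

Lemma discriminant_le (R : realType) (a b c : R) :
  0 <= c -> (forall t, 0 <= a + t * b *+ 2 + t ^+ 2 * c) -> b ^+ 2 <= a * c.
Proof.
move=> c_ge0 H; have [c0|c_neq0] := eqVneq c 0.
  have [->|b_neq0] := eqVneq b 0; first by rewrite c0 mulr0 expr0n.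
  have := H (- (a + 1) / (b *+ 2)).
  by rewrite -mulrnAr divfK ?mulrn_eq0// c0; lra.
have c_gt0 : 0 < c by rewrite lt_def c_neq0.
have := H (- b / c).
rewrite -(ler_pM2r c_gt0) mul0r.
have -> : (a + - b / c * b *+ 2 + (- b / c) ^+ 2 * c) * c = a * c - b ^+ 2.
  by field.
by rewrite subr_ge0.
Qed.

Section InnerProduct.
Context {R : realType} {V : hilbertType R}.
Implicit Types (x y z : V) (a : R).

Lemma dotp0r x : dotp x (0 : V) = 0.
Proof. by rewrite -(scale0r (0 : V)) dotpZr mul0r. Qed.

Lemma dotp0l x : dotp (0 : V) x = 0.
Proof. by rewrite dotpC dotp0r. Qed.

Lemma dotpNr x y : dotp x (- y) = - dotp x y.
Proof. by rewrite -scaleN1r dotpZr mulN1r. Qed.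

Lemma dotpNl x y : dotp (- x) y = - dotp x y.
Proof. by rewrite dotpC dotpNr dotpC. Qed.

Lemma dotpBr x y z : dotp x (y - z) = dotp x y - dotp x z.
Proof. by rewrite dotpDr dotpNr. Qed.

Lemma dotpBl x y z : dotp (x - y) z = dotp x z - dotp y z.
Proof. by rewrite dotpDl dotpNl. Qed.

Lemma dotp_suml (I : Type) (s : seq I) (F : I -> V) y :
  dotp (\sum_(i <- s) F i) y = \sum_(i <- s) dotp (F i) y.
Proof.
elim: s => [|i s IH]; first by rewrite !big_nil dotp0l.
by rewrite !big_cons dotpDl IH.
Qed.

Lemma sqr_normD x y : `|x + y| ^+ 2 = `|x| ^+ 2 + dotp x y *+ 2 + `|y| ^+ 2.
Proof.
by rewrite -!dotp_norm dotpDl !dotpDr (dotpC y x) mulr2n !addrA.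
Qed.

Lemma sqr_normB x y : `|x - y| ^+ 2 = `|x| ^+ 2 - dotp x y *+ 2 + `|y| ^+ 2.
Proof. by rewrite sqr_normD dotpNr mulNrn normrN. Qed.

Lemma dotp_eq0 x : dotp x x = 0 -> x = 0.
Proof. by rewrite dotp_norm => /eqP; rewrite sqrf_eq0 normr_eq0 => /eqP. Qed.

Lemma dotp_inj x y : (forall z, dotp x z = dotp y z) -> x = y.
Proof.
move=> xy; apply/eqP; rewrite -subr_eq0; apply/eqP/dotp_eq0.
by rewrite dotpBl xy subrr.
Qed.

Lemma cauchy_schwarz x y : `|dotp x y| <= `|x| * `|y|.
Proof.
rewrite -ler_sqr ?nnegrE ?mulr_ge0// exprMn real_normK ?num_real//.
apply: discriminant_le => [|t]; first exact: sqr_ge0.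
have := sqr_ge0 `|x + t *: y|.
by rewrite sqr_normD dotpZr normrZ exprMn real_normK ?num_real.
Qed.

(** This is the Cauchy-Schwarz inequality of the nonnegative form
   [dotp (C x) y], applied to [x] and [y = C x]. *)
Lemma nonneg_sqr_norm_le (C : {linear V -> V}) (M : R) :
  selfadjoint C -> nonnegative C -> (forall x, `|C x| <= M * `|x|) ->
  forall x, `|C x| ^+ 2 <= M * dotp (C x) x.
Proof.
move=> sC nC CM x; have [->|Cx_neq0] := eqVneq (C x) 0.
  by rewrite normr0 expr0n /= dotp0l mulr0.
have Cx_gt0 : 0 < `|C x| ^+ 2 by rewrite exprn_gt0// normr_gt0.
have CS : (`|C x| ^+ 2) ^+ 2 <= dotp (C x) x * dotp (C (C x)) (C x).
  apply: discriminant_le => // t.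
  have := nC (x + t *: C x).
  have -> : C (x + t *: C x) = C x + t *: C (C x) by rewrite linearD linearZ.
  rewrite dotpDl !dotpDr !dotpZl !dotpZr (sC (C x) x).
  by rewrite !dotp_norm; lra.
rewrite -(ler_pM2r Cx_gt0) -expr2; apply: (le_trans CS).
rewrite (mulrC M) -mulrA ler_wpM2l//.
apply: (le_trans (ler_norm _)); apply: (le_trans (cauchy_schwarz _ _)).
by rewrite expr2 mulrA ler_wpM2r.
Qed.

End InnerProduct.

(** * Riesz representation on a subspace *)

Lemma le_harmonic_le0 (R : realType) (a c : R) :
  (forall n, a <= c / n.+1%:R) -> a <= 0.
Proof.
move=> H; rewrite leNgt; apply/negP => a_gt0.
have := truncnS_gt (c / a); rewrite ltr_pdivrMr// ltNge => /negP; apply.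
by rewrite mulrC -ler_pdivlMr ?ltr0n.
Qed.

(** Completeness with an explicit rate: equalities about the limit then follow
   from [le_harmonic_le0]. *)
Lemma harmonic_cauchy_cvg (R : realType) (V : completeNormedModType R)
    (u : nat -> V) (c : R) :
  (forall n k, (n <= k)%N -> `|u n - u k| <= c / n.+1%:R) ->
  exists l, forall n, `|u n - l| <= c / n.+1%:R.
Proof.
move=> uc; have c_ge0 : 0 <= c.
  by have := le_trans (normr_ge0 _) (uc 0 0 (leqnn 0)); rewrite divr1.
have small e : 0 < e -> exists N, c / N.+1%:R < e.
  move=> e_gt0; exists (Num.truncn (c / e)).
  by rewrite ltr_pdivrMr ?ltr0n// mulrC -ltr_pdivrMr// truncnS_gt.
have cu : cvgn u.
  apply: cauchy_cvg; apply: cauchy_exP => e /small[N Ne]; exists (u N).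
  exists N => // n /= Nn; rewrite -ball_normE /=.
  exact: le_lt_trans (uc _ _ Nn) Ne.
exists (limn u) => n; apply/ler_addgt0Pr => e e_gt0.
have /cvgrPdist_lt/(_ e e_gt0)[N _ uN] := cu.
have {}uN := uN (maxn N n) (leq_maxl _ _).
rewrite (_ : _ - _ = (u n - u (maxn N n)) - (limn u - u (maxn N n))); last first.
  by rewrite opprB [RHS]addrA subrK.
apply: (le_trans (ler_normB _ _)); rewrite lerD ?(ltW uN)//.
exact/uc/leq_maxr.
Qed.

Section Riesz.
Context {R : realType} {V : hilbertType R}.

Lemma dotp_closure_eq0 (y u : V) :
  (forall e, 0 < e -> exists2 v, `|y - v| < e & dotp v u = 0) -> dotp y u = 0.
Proof.
move=> yu; apply/eqP; rewrite -normr_le0; apply/ler_addgt0Pr => e e_gt0.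
have d_gt0 : 0 < e / (`|u| + 1) by rewrite divr_gt0// ltr_wpDl.
have [v yv vu] := yu _ d_gt0; rewrite add0r -[dotp y u]subr0 -vu -dotpBl.
apply: (le_trans (cauchy_schwarz _ _)).
apply: (@le_trans _ _ (e / (`|u| + 1) * (`|u| + 1))).
  by rewrite ler_pM ?(ltW yv)// lerDl.
by rewrite divfK// gt_eqF// ltr_wpDl.
Qed.

(** The functional [v |-> r] is given by its graph [G], a subspace of [V * R], so
   that it may be defined on any subspace, such as the range of an operator or
   the span of a set.  The representing vector [y] minimises
   [`|v| ^+ 2 - r *+ 2]: by the parallelogram law minimising sequences are
   Cauchy, and the variation of the minimum in the direction [v] gives
   [dotp y v = r].  It is the only representing vector in the closure of the
   domain of [G]. *)
Lemma riesz_graph (G : V -> R -> Prop) (c : R) :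
  0 <= c -> G 0 0 ->
  (forall a v r v' r', G v r -> G v' r' -> G (a *: v + v') (a * r + r')) ->
  (forall v r, G v r -> `|r| <= c * `|v|) ->
  exists y, [/\ forall v r, G v r -> dotp y v = r,
    forall e, 0 < e -> exists v r, G v r /\ `|y - v| < e & `|y| <= c].
Proof.
move=> c_ge0 G0 GD Gc.
pose J (v : V) (r : R) := `|v| ^+ 2 - r *+ 2.
pose S := [set s | exists v r, G v r /\ s = J v r]%classic.
have J_ge v r : G v r -> - c ^+ 2 <= J v r.
  move=> /Gc; rewrite /J; have := sqr_ge0 (`|v| - c); have := ler_norm r.
  by rewrite sqrrB; set x := `|v|; nra.
have GZ a v r : G v r -> G (a *: v) (a * r).
  by move=> Gvr; have := GD a v r 0 0 Gvr G0; rewrite !addr0.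
have infS : has_inf S.
  split; first by exists (J 0 0); exists 0, 0.
  by exists (- c ^+ 2) => _ [v [r [Gvr ->]]]; exact: J_ge.
pose m := inf S.
have J_m v r : G v r -> m <= J v r.
  by move=> Gvr; apply: ge_inf; [case: infS | exists v, r].
(* The squared rate makes the minimising sequence Cauchy at rate [2 / n.+1]. *)
have /choice[p pP] n : exists p : V * R,
    G p.1 p.2 /\ J p.1 p.2 <= m + n.+1%:R^-1 ^+ 2.
  have : (0 : R) < n.+1%:R^-1 ^+ 2 by rewrite exprn_gt0// invr_gt0.
  move=> /inf_adherent/(_ infS)[_ [v [r [Gvr ->]]] /ltW lem].
  by exists (v, r).
have Gp n : G (p n).1 (p n).2 by case: (pP n).
have Jp n : J (p n).1 (p n).2 <= m + n.+1%:R^-1 ^+ 2 by case: (pP n).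
have [y yP] : exists l, forall n, `|(p n).1 - l| <= 2 / n.+1%:R.
  apply: harmonic_cauchy_cvg => n k nk.
  rewrite -ler_sqr ?nnegrE ?divr_ge0//.
  (* Parallelogram law: the midpoint of two terms is in the domain of [G]. *)
  have := J_m _ _ (GD 2^-1 _ _ _ _ (Gp n) (GZ 2^-1 _ _ (Gp k))).
  have := Jp n; have := Jp k.
  have : (k.+1%:R^-1 : R) ^+ 2 <= n.+1%:R^-1 ^+ 2.
    by rewrite ler_sqr ?nnegrE ?invr_ge0// lef_pV2 ?posrE ?ltr0n// ler_nat.
  rewrite /J exprMn -scalerDr.
  rewrite normrZ exprMn sqr_normD sqr_normB real_normK ?num_real//.
  set a := `|_|; set b := `|_|; set d := dotp _ _.
  set ek := k.+1%:R^-1 ^+ 2; set en := n.+1%:R^-1 ^+ 2.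
  have -> : (2^-1 : R) ^+ 2 = 4^-1 by rewrite exprVn -natrX.
  by lra.
have yG v r : G v r -> dotp y v = r.
  move=> Gvr.
  have pvr n : `|dotp (p n).1 v - r| <= `|v| / n.+1%:R.
    rewrite -ler_sqr ?nnegrE ?divr_ge0// real_normK ?num_real// exprMn mulrC.
    apply: discriminant_le => [|t]; first exact: sqr_ge0.
    have := J_m _ _ (GD t _ _ _ _ Gvr (Gp n)); have := Jp n.
    rewrite /J sqr_normD normrZ exprMn real_normK ?num_real// dotpZl dotpC.
    move: (`|(p n).1|) (n.+1%:R^-1 : R) `|v| (dotp _ v) => a e b d.
    by rewrite mulrBr; nra.
  apply/eqP; rewrite -subr_eq0 -normr_le0.
  apply: (@le_harmonic_le0 _ _ (3 * `|v|)) => n.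
  rewrite -(subrK (dotp (p n).1 v) (dotp y v)) -addrA -dotpBl.
  apply: (le_trans (ler_normD _ _)).
  rewrite (_ : 3 * _ / _ = 2 / n.+1%:R * `|v| + `|v| / n.+1%:R); last by ring.
  rewrite lerD ?pvr//; apply: (le_trans (cauchy_schwarz _ _)).
  by rewrite ler_wpM2r// distrC.
have yclose e : 0 < e -> exists v r, G v r /\ `|y - v| < e.
  move=> e_gt0; have lt_e : 2 / (Num.truncn (2 / e)).+1%:R < e.
    by rewrite ltr_pdivrMr ?ltr0n// mulrC -ltr_pdivrMr// truncnS_gt.
  exists (p (Num.truncn (2 / e))).1, (p (Num.truncn (2 / e))).2; split => //.
  by rewrite distrC; apply: le_lt_trans (yP _) lt_e.
exists y; split => //.
have [->|y_neq0] := eqVneq y 0; first by rewrite normr0.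
have y_gt0 : 0 < `|y| by rewrite normr_gt0.
rewrite -(ler_pM2r y_gt0) -expr2 -dotp_norm; apply/ler_addgt0Pr => e e_gt0.
have d_gt0 : 0 < c + `|y| by rewrite ltr_wpDl.
have [v [r [Gvr /ltW yv]]] := yclose _ (divr_gt0 e_gt0 d_gt0).
rewrite -{2}(subrK v y) dotpDr (yG _ _ Gvr).
have := Gc _ _ Gvr; have := ler_norm r.
have := le_trans (ler_norm _) (cauchy_schwarz y (y - v)).
have vy : `|v| <= `|y| + `|y - v|.
  by rewrite distrC -{1}(subrK y v) addrC ler_normD.
have := ler_wpM2l c_ge0 vy.
have : `|y - v| * (c + `|y|) <= e by rewrite -ler_pdivlMr.
move: (dotp y _) `|y - v| `|v| `|y| `|r| => d a b s t.
by rewrite !mulrDr (mulrC a c) (mulrC a s); lra.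
Qed.

End Riesz.

(** * Bounded operators and their adjoints *)

Definition linear_of (R : pzRingType) (U W : lmodType R) (f : U -> W)
    (lf : linear f) : {linear U -> W} :=
  HB.pack f (GRing.isLinear.Build _ _ _ _ _ lf).

Section BoundedOperators.
Context {R : realType} {V W : normedModType R}.

Lemma continuous_bounded (f : {linear V -> W}) :
  continuous f -> exists2 M, 0 < M & forall x, `|f x| <= M * `|x|.
Proof.
move=> /linear_bounded_continuous/linear_boundedP [M [_ fM]].
exists (`|M| + 1); first by rewrite ltr_wpDl.
by apply: fM; rewrite (le_lt_trans (ler_norm M))// ltrDl.
Qed.

Lemma bounded_continuous (f : {linear V -> W}) (M : R) :
  (forall x, `|f x| <= M * `|x|) -> continuous f.
Proof.
move=> fM; apply/linear_bounded_continuous/linear_boundedP.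
exists M; split=> [|r Mr x]; first exact: num_real.
by rewrite (le_trans (fM x))// ler_wpM2r// ltW.
Qed.

End BoundedOperators.

Definition adjoint_pair (R : realType) (V W : hilbertType R)
  (f : V -> W) (g : W -> V) := forall x y, dotp (f x) y = dotp x (g y).

Section Adjoints.
Context {R : realType}.

Lemma adjoint_pair_sym (V W : hilbertType R) (f : V -> W) (g : W -> V) :
  adjoint_pair f g -> adjoint_pair g f.
Proof. by move=> fg x y; rewrite dotpC -fg dotpC. Qed.

Lemma adjoint_pair_comp (V W X : hilbertType R) (f : V -> W) (f' : W -> V)
    (g : W -> X) (g' : X -> W) :
  adjoint_pair f f' -> adjoint_pair g g' -> adjoint_pair (g \o f) (f' \o g').
Proof. by move=> ff gg x y /=; rewrite gg ff. Qed.

Lemma adjoint_pair_linear (V W : hilbertType R) (f : {linear V -> W})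
    (g : W -> V) :
  adjoint_pair f g -> linear g.
Proof.
move=> fg a x y; apply: dotp_inj => z.
by rewrite dotpC -fg dotpDl dotpZl ![dotp (g _) z]dotpC -!fg dotpDr dotpZr.
Qed.

Lemma adjoint_pair_bound (V W : hilbertType R) (f : V -> W) (g : W -> V) (M : R) :
  0 <= M -> adjoint_pair f g -> (forall x, `|f x| <= M * `|x|) ->
  forall y, `|g y| <= M * `|y|.
Proof.
move=> M_ge0 fg fM y; have [->|gy0] := eqVneq (g y) 0.
  by rewrite normr0 mulr_ge0.
have gy_gt0 : 0 < `|g y| by rewrite normr_gt0.
rewrite -(ler_pM2r gy_gt0) -expr2 -dotp_norm -fg.
apply: (le_trans (ler_norm _)); apply: (le_trans (cauchy_schwarz _ _)).
by rewrite mulrAC ler_wpM2r.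
Qed.

Lemma adjoint_exists (V W : hilbertType R) (f : {linear V -> W}) (M : R) :
  0 <= M -> (forall x, `|f x| <= M * `|x|) ->
  exists g : {linear W -> V}, adjoint_pair f g.
Proof.
move=> M_ge0 fM.
have /choice[g gP] w : exists y, forall x, dotp (f x) w = dotp x y.
  pose G v r := r = dotp (f v) w.
  have [|||v r|y [yP _ _]] := @riesz_graph _ V G (M * `|w|).
  - by rewrite mulr_ge0.
  - by rewrite /G linear0 dotp0l.
  - by move=> a v r v' r' -> ->; rewrite /G linearP dotpDl dotpZl.
  - move=> ->; apply: (le_trans (cauchy_schwarz _ _)).
    by rewrite mulrAC ler_wpM2r.
  - by exists y => x; rewrite [RHS]dotpC (yP x (dotp (f x) w)).
have fg : adjoint_pair f g by move=> x y; exact: gP.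
by exists (linear_of (adjoint_pair_linear fg)).
Qed.

(** Douglas factorisation.  The adjoint [U'] is built first: [U' z] represents
   the functional [f x |-> dotp z (g x)] on the range of [f], which is well
   defined and bounded by [`|z|] because [f] dominates [g].  Choosing
   representatives in the closure of the range makes [U'] linear; this closure
   is used through orthogonality to the vectors orthogonal to the range. *)
Lemma douglas (X V W : hilbertType R) (f : {linear X -> V})
    (g : {linear X -> W}) :
  (forall x, `|g x| <= `|f x|) ->
  exists (U : {linear V -> W}) (U' : {linear W -> V}),
    [/\ adjoint_pair U U', forall x, U (f x) = g x & forall v, `|U v| <= `|v|].
Proof.
move=> gf.
have /choice[h hP] z : exists y, [/\ forall x, dotp y (f x) = dotp z (g x),
    forall u, (forall x, dotp (f x) u = 0) -> dotp y u = 0 & `|y| <= `|z|].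
  pose G v r := exists x, v = f x /\ r = dotp z (g x).
  have [|||v r|y [yP yG y_le]] := @riesz_graph _ V G `|z|.
  - by [].
  - by exists 0; rewrite !linear0.
  - move=> a v r v' r' [x [-> ->]] [x' [-> ->]]; exists (a *: x + x').
    by rewrite !linearP.
  - move=> [x [-> ->]]; apply: (le_trans (cauchy_schwarz _ _)).
    by rewrite ler_wpM2l.
  - exists y; split=> [x|u uf|//]; first by apply: yP; exists x.
    apply: dotp_closure_eq0 => e /yG [_ [_ [[x [-> _]] yfx]]].
    by exists (f x).
have hf z x : dotp (h z) (f x) = dotp z (g x) by case: (hP z).
have h_orth z u : (forall x, dotp (f x) u = 0) -> dotp (h z) u = 0.
  by move=> fu; have [_ + _] := hP z; apply.
have h_le z : `|h z| <= 1 * `|z| by rewrite mul1r; case: (hP z).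
have lh : linear h.
  move=> a z z'; apply/eqP; rewrite -subr_eq0; apply/eqP/dotp_eq0.
  set u := _ - _; have uf x : dotp (f x) u = 0.
    by rewrite dotpC /u dotpBl dotpDl dotpZl !hf dotpDl dotpZl subrr.
  by rewrite {1}/u dotpBl dotpDl dotpZl !h_orth// mulr0 addr0 subr0.
have [U hU] := @adjoint_exists _ _ (linear_of lh) 1 ler01 h_le.
exists U, (linear_of lh); split => [|x|v].
- exact: adjoint_pair_sym.
- by apply: dotp_inj => z; rewrite dotpC -hU hf dotpC.
- by rewrite -[leRHS]mul1r; apply: (adjoint_pair_bound ler01 hU h_le).
Qed.

End Adjoints.

(** * Orthonormal bases *)

Definition orthonormal_set (R : realType) (V : hilbertType R) (E : set V) :=
  (forall e, E e -> dotp e e = 1) /\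
  (forall e f, E e -> E f -> e <> f -> dotp e f = 0).

Section Orthonormal.
Context {R : realType} {V : hilbertType R}.
Implicit Types (E : set V) (x : V).

Lemma orthonormal_basisW E : orthonormal_basis E -> orthonormal_set E.
Proof. by case. Qed.

(** An orthonormal basis is exactly a maximal orthonormal set, as given by Zorn's
   lemma. *)
Lemma orthonormal_basis_exists : exists E : set V, orthonormal_basis E.
Proof.
have [F FP tF|E [[E1 E0] maxE]] := @Zorn_bigcup V (@orthonormal_set R V).
  split=> [e [A /FP[A1 _] /A1]//|e f [A FA Ae] [B FB Bf]].
  have [AB|BA] := tF _ _ FA FB.
    by apply: (proj2 (FP _ FB)) => //; exact: AB.
  by apply: (proj2 (FP _ FA)) => //; exact: BA.
exists E; split => // x xE; apply: contrapT => /eqP x_neq0.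
have x_gt0 : 0 < `|x| by rewrite normr_gt0.
pose u := `|x|^-1 *: x.
have uE e : E e -> dotp u e = 0.
  by move=> /xE; rewrite dotpZl => ->; rewrite mulr0.
have uu : dotp u u = 1.
  by rewrite dotpZl dotpZr dotp_norm expr2 mulKf ?mulVf// gt_eqF.
have nEu : ~ E u by move=> /uE; rewrite uu => /eqP; rewrite oner_eq0.
apply: (maxE (E `|` [set u])%classic).
  split=> [|EuE]; first exact: subsetUl.
  by apply/nEu/EuE; right.
split=> [e [/E1//|->//]|e f [Ee|->] [Ef|->]] ef; first exact: E0.
- by rewrite dotpC uE.
- by rewrite uE.
- by [].
Qed.

(** When [s] is orthonormal, this is the orthogonal projection on its span. *)
Definition fourier_sum (s : seq V) x : V := \sum_(e <- s) dotp x e *: e.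

Section FourierSum.
Variables (E : set V) (s : seq V).
Hypotheses (oE : orthonormal_set E) (us : uniq s) (sE : forall e, e \in s -> E e).

Lemma fourier_sum_orth x e : e \in s -> dotp (x - fourier_sum s x) e = 0.
Proof.
case: oE => E1 E0 es; rewrite dotpBl dotp_suml (bigD1_seq e)//=.
rewrite dotpZl (E1 _ (sE es)) mulr1 big_seq_cond.
rewrite big1 ?addr0 ?subrr// => f /andP[fs /eqP fe].
by rewrite dotpZl (E0 _ _ (sE fs) (sE es) fe) mulr0.
Qed.

Lemma sqr_norm_fourier_sum x :
  `|x - fourier_sum s x| ^+ 2 = `|x| ^+ 2 - \sum_(e <- s) dotp x e ^+ 2.
Proof.
rewrite -dotp_norm {2}/fourier_sum dotpBr (dotpC _ (fourier_sum s x)).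
rewrite {2}/fourier_sum dotp_suml big_seq big1 => [|e es]; last first.
  by rewrite dotpZl [dotp e _]dotpC fourier_sum_orth// mulr0.
rewrite subr0 dotpBl dotp_norm dotp_suml; congr (_ - _).
by apply: eq_bigr => e _; rewrite dotpZl dotpC expr2.
Qed.

Lemma bessel_seq x : \sum_(e <- s) dotp x e ^+ 2 <= `|x| ^+ 2.
Proof. by rewrite -subr_ge0 -sqr_norm_fourier_sum sqr_ge0. Qed.

(** The hypothesis on [v] puts it in the span of [s], without naming its
   coefficients. *)
Lemma fourier_sum_best x v :
  (forall u, (forall e, e \in s -> dotp e u = 0) -> dotp v u = 0) ->
  `|x - fourier_sum s x| ^+ 2 <= `|x - v| ^+ 2.
Proof.
move=> vs; set y := fourier_sum s x.
have yo e : e \in s -> dotp e (x - y) = 0.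
  by move=> es; rewrite dotpC fourier_sum_orth.
have yy : dotp y (x - y) = 0.
  rewrite {1}/y dotp_suml big_seq big1// => e es; by rewrite dotpZl yo ?mulr0.
have -> : x - v = (x - y) + (y - v) by rewrite addrA subrK.
rewrite [leRHS]sqr_normD dotpBr (dotpC _ y) yy (dotpC _ v) vs//.
by rewrite subrr mul0rn addr0 lerDl sqr_ge0.
Qed.

End FourierSum.

Local Open Scope ereal_scope.

Lemma esum_le_seq (T : choiceType) (S : set T) (a : T -> R) (M : \bar R) :
  (forall s : seq T, uniq s -> (forall e, e \in s -> S e) ->
     (\sum_(e <- s) a e)%:E <= M) ->
  \esum_(e in S) (a e)%:E <= M.
Proof.
move=> H; apply: ge_ereal_sup => _ [X [fX XS] <-].
rewrite fsbig_finite//= sumEFin; apply: H; first exact: fset_uniq.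
by move=> e; rewrite in_fset_set// inE => /XS.
Qed.

Lemma seq_le_esum (T : choiceType) (S : set T) (a : T -> R) (s : seq T) :
  uniq s -> (forall e, e \in s -> S e) ->
  (\sum_(e <- s) a e)%:E <= \esum_(e in S) (a e)%:E.
Proof.
move=> us sS; apply: esum_ge; exists [set` s]%classic.
  by split; [exact: finite_seq | exact: sS].
by rewrite -fsbig_seq// sumEFin.
Qed.

Lemma bessel E x : orthonormal_set E ->
  \esum_(e in E) (dotp x e ^+ 2)%:E <= (`|x| ^+ 2)%:E.
Proof.
by move=> oE; apply: esum_le_seq => s us sE; rewrite lee_fin (bessel_seq oE).
Qed.

(** The vector representing [dotp x] on the span of [E] differs from [x] by a
   vector orthogonal to [E], so it is [x], and [x] is a limit of finite
   combinations of [E]; projections approximate at least as well as these. *)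
Lemma parseval_le E x : orthonormal_basis E ->
  (`|x| ^+ 2)%:E <= \esum_(e in E) (dotp x e ^+ 2)%:E.
Proof.
move=> bE; have oE := orthonormal_basisW bE.
pose span v := exists l : seq (R * V),
  (forall p, p \in l -> E p.2) /\ v = (\sum_(p <- l) p.1 *: p.2)%R.
pose G v r := span v /\ r = dotp x v.
have [||||y [yG yclose _]] := @riesz_graph _ V G `|x|.
- by [].
- by split; [exists [::]; split => //; rewrite big_nil | rewrite dotp0r].
- move=> a v r v' r' [[l [lE ->]] ->] [[l' [lE' ->]] ->]; split; last first.
    by rewrite dotpDr dotpZr.
  exists ([seq (a * p.1, p.2)%R | p <- l] ++ l'); split.
    by move=> p; rewrite mem_cat => /orP[/mapP[q /lE qE ->]|/lE'].
  rewrite big_cat big_map/= scaler_sumr; congr (_ + _)%R.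
  by apply: eq_bigr => p _; rewrite scalerA.
- by move=> v r [_ ->]; exact: cauchy_schwarz.
have yx : y = x.
  apply/eqP; rewrite -subr_eq0; apply/eqP; case: bE => _ _; apply => e Ee.
  rewrite dotpBl (yG e (dotp x e)) ?subrr//; split => //.
  exists [:: (1%R, e)]; rewrite big_seq1 scale1r; split => // p.
  by rewrite inE => /eqP ->.
apply/lee_addgt0Pr => d d_gt0.
have /yclose[_ [_ [[[l [lE ->]] _] ly]]] : (0 < Num.sqrt d)%R.
  by rewrite sqrtr_gt0.
pose s := undup [seq p.2 | p <- l].
have sE e : e \in s -> E e by rewrite mem_undup => /mapP[p /lE pE ->].
have us : uniq s by exact: undup_uniq.
apply: (@le_trans _ _ ((\sum_(e <- s) dotp x e ^+ 2)%:E + d%:E)); last first.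
  by rewrite leeD2r// seq_le_esum.
rewrite -EFinD lee_fin -lerBlDl -(sqr_norm_fourier_sum oE us sE).
have best := fourier_sum_best oE us sE x (v := (\sum_(p <- l) p.1 *: p.2)%R).
apply: le_trans (best _) _ => [u us0|].
  rewrite dotp_suml big_seq big1// => p pl; rewrite dotpZl us0 ?mulr0//.
  by rewrite mem_undup map_f.
rewrite -(sqr_sqrtr (ltW d_gt0)) ler_sqr ?nnegrE ?sqrtr_ge0//.
by rewrite -yx; exact: ltW ly.
Qed.

End Orthonormal.

(** * Square roots of nonnegative operators *)

Section SquareRoot.
Context {R : realType} {V : hilbertType R}.

(** Solving [Y = (Z + Y ^ 2) / 2] amounts to [(1 - Y) ^ 2 = 1 - Z].  The
   iteration of this equation from [0] is dominated, together with its
   increments, by the same iteration for [Z = 1] in the scalars, which converges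
   to [1]. *)
Fixpoint operator_iter (Z : V -> V) (n : nat) (x : V) : V :=
  if n is n'.+1 then 2^-1 *: (Z x + operator_iter Z n' (operator_iter Z n' x))
  else 0.

Fixpoint scalar_iter (n : nat) : R :=
  if n is n'.+1 then 2^-1 * (1 + scalar_iter n' ^+ 2) else 0.

Lemma scalar_iter_ge0 n : 0 <= scalar_iter n.
Proof. by case: n => //= n; rewrite mulr_ge0 ?invr_ge0 ?addr_ge0 ?sqr_ge0. Qed.

Lemma scalar_iter_le1 n : scalar_iter n <= 1.
Proof.
elim: n => //= n IH; have := scalar_iter_ge0 n.
by move: (scalar_iter n) IH => a; nra.
Qed.

Lemma scalar_iter_nd n k : (n <= k)%N -> scalar_iter n <= scalar_iter k.
Proof.
elim: k => [|k IH]; first by rewrite leqn0 => /eqP ->.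
rewrite leq_eqVlt => /predU1P[->//|/IH]; move/le_trans; apply => /=.
have := sqr_ge0 (1 - scalar_iter k).
by move: (scalar_iter k) => a; nra.
Qed.

(** With [b = 1 - scalar_iter n] the iteration reads [b - b ^+ 2 / 2]. *)
Lemma scalar_iter_rate n : 1 - scalar_iter n <= 2 / n.+1%:R.
Proof.
apply: (@le_trans _ _ (2 / n.+2%:R)); last first.
  by rewrite ler_wpM2l// lef_pV2 ?posrE ?ltr0n// ler_nat.
elim: n => [|n IH] /=; first by rewrite subr0 divff ?pnatr_eq0.
have a1 := scalar_iter_le1 n; have a0 := scalar_iter_ge0 n.
have n2 : (2 : R) <= n.+2%:R by rewrite ler_nat.
rewrite -[n.+3]addn1 natrD.
move: (n.+2%:R : R) (scalar_iter n) n2 a1 a0 IH => m a m2 a1 a0.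
have m0 : 0 < m by lra.
rewrite !ler_pdivlMr; [|by lra|by []] => IH.
set b := 1 - a; have bE : a = 1 - b by rewrite /b; ring.
rewrite bE in a0 a1 IH *.
have : 0 <= b * m <= 2 by nra.
nra.
Qed.

Variable Z : {linear V -> V}.
Hypothesis (Z_sa : selfadjoint Z) (Z_le : forall x, `|Z x| <= `|x|).
Let Y := operator_iter Z.

Lemma operator_iter_linear n : linear (Y n).
Proof.
elim: n => [|n IH] a x y /=; first by rewrite scaler0 addr0.
rewrite /Y /= -/Y !IH linearP /= !scalerDr !scalerA mulrC.
by rewrite -!addrA; congr (_ + _); rewrite addrCA.
Qed.

Lemma operator_iter_selfadjoint n x y : dotp (Y n x) y = dotp x (Y n y).
Proof.
elim: n x y => [|n IH] x y; first by rewrite dotp0l dotp0r.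
by rewrite /Y /= -/Y dotpZl dotpZr dotpDl dotpDr Z_sa !IH.
Qed.

Lemma operator_iter_le n x : `|Y n x| <= scalar_iter n * `|x|.
Proof.
elim: n x => [|n IH] x; first by rewrite normr0 mul0r.
rewrite /Y /= -/Y normrZ gtr0_norm ?invr_gt0// -mulrA ler_wpM2l ?invr_ge0//.
rewrite mulrDl mul1r (le_trans (ler_normD _ _))// lerD//.
rewrite (le_trans (IH _))// expr2 -mulrA ler_wpM2l//.
exact: scalar_iter_ge0.
Qed.

Lemma operator_iterB_step n x :
  `|Y n.+1 x - Y n x| <= (scalar_iter n.+1 - scalar_iter n) * `|x|.
Proof.
elim: n x => [|n IH] x.
  rewrite /Y /= addr0 subr0 normrZ expr0n /= addr0 subr0 mulr1.
  by rewrite gtr0_norm ?invr_gt0// ler_wpM2l ?invr_ge0.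
have YB m u v : Y m (u - v) = Y m u - Y m v.
  exact: (linearB (linear_of (operator_iter_linear m))).
(* With [D] the previous increment, [Y n.+1 ^ 2 - Y n ^ 2] is
   [Y n.+1 D + D Y n]. *)
have -> : Y n.+2 x - Y n.+1 x =
    2^-1 *: (Y n.+1 (Y n.+1 x - Y n x) + (Y n.+1 (Y n x) - Y n (Y n x))).
  rewrite YB addrA subrK -[Y n.+2 x]/(2^-1 *: (Z x + Y n.+1 (Y n.+1 x))).
  rewrite -{2}[Y n.+1 x]/(2^-1 *: (Z x + Y n (Y n x))).
  by rewrite -scalerBr opprD addrACA subrr add0r.
have -> : scalar_iter n.+2 - scalar_iter n.+1 =
    2^-1 * (scalar_iter n.+1 * (scalar_iter n.+1 - scalar_iter n)
           + (scalar_iter n.+1 - scalar_iter n) * scalar_iter n).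
  rewrite -[scalar_iter n.+2]/(2^-1 * (1 + scalar_iter n.+1 ^+ 2)).
  rewrite -{2}[scalar_iter n.+1]/(2^-1 * (1 + scalar_iter n ^+ 2)).
  by ring.
rewrite normrZ gtr0_norm ?invr_gt0// -mulrA ler_wpM2l ?invr_ge0//.
rewrite (le_trans (ler_normD _ _))// mulrDl.
rewrite -(mulrA (scalar_iter n.+1)) -(mulrA _ (scalar_iter n)) lerD//.
  rewrite (le_trans (operator_iter_le _ _))// ler_wpM2l//.
  exact: scalar_iter_ge0.
rewrite (le_trans (IH _))// ler_wpM2l ?operator_iter_le// subr_ge0.
exact: scalar_iter_nd.
Qed.

Lemma operator_iterB_le n k x : (n <= k)%N ->
  `|Y n x - Y k x| <= (scalar_iter k - scalar_iter n) * `|x|.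
Proof.
elim: k => [|k IH].
  by rewrite leqn0 => /eqP ->; rewrite !subrr normr0 mul0r.
rewrite leq_eqVlt => /predU1P[->|/IH nk]; first by rewrite !subrr normr0 mul0r.
rewrite -(subrK (Y k x) (Y n x)) -addrA (le_trans (ler_normD _ _))//.
have -> : scalar_iter k.+1 - scalar_iter n =
    (scalar_iter k - scalar_iter n) + (scalar_iter k.+1 - scalar_iter k).
  by rewrite [RHS]addrC addrA subrK.
by rewrite mulrDl lerD// distrC operator_iterB_step.
Qed.

Lemma operator_iter_fixpoint : exists Y : {linear V -> V},
  [/\ selfadjoint Y, forall x, `|Y x| <= `|x| &
      forall x, Y x *+ 2 = Z x + Y (Y x)].
Proof.
have /choice[L L_lim] x :
    exists l, forall n, `|Y n x - l| <= (2 * `|x|) / n.+1%:R.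
  apply: harmonic_cauchy_cvg => n k nk.
  apply: (le_trans (operator_iterB_le x nk)); rewrite mulrAC ler_wpM2r//.
  by rewrite (le_trans _ (scalar_iter_rate n))// lerD2r scalar_iter_le1.
have L_sa x y : dotp (L x) y = dotp x (L y).
  apply/eqP; rewrite -subr_eq0 -normr_le0.
  apply: (@le_harmonic_le0 _ _ (4 * (`|x| * `|y|))) => n.
  have -> : dotp (L x) y - dotp x (L y) =
      dotp x (Y n y - L y) - dotp (Y n x - L x) y.
    by rewrite dotpBl dotpBr operator_iter_selfadjoint; ring.
  apply: (le_trans (ler_normB _ _)).
  have -> : 4 * (`|x| * `|y|) / n.+1%:R =
      `|x| * (2 * `|y| / n.+1%:R) + 2 * `|x| / n.+1%:R * `|y|.
    by ring.
  apply: lerD; apply: (le_trans (cauchy_schwarz _ _)).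
    by rewrite ler_wpM2l.
  by rewrite ler_wpM2r.
have L_linear : linear L.
  move=> a x y; apply: dotp_inj => z.
  by rewrite dotpDl dotpZl !L_sa dotpDl dotpZl.
have L_le x : `|L x| <= `|x|.
  rewrite -subr_le0; apply: (@le_harmonic_le0 _ _ (2 * `|x|)) => n.
  rewrite lerBlDl -{1}(subrK (Y n x) (L x)) addrC.
  apply: (le_trans (ler_normD _ _)); rewrite lerD 1?distrC//.
  rewrite (le_trans (operator_iter_le _ _))// -[leRHS]mul1r ler_wpM2r//.
  exact: scalar_iter_le1.
exists (linear_of L_linear); split => //= x.
apply/eqP; rewrite -subr_eq0 -normr_le0.
apply: (@le_harmonic_le0 _ _ (8 * `|x|)) => n.
have LB u v : L (u - v) = L u - L v by exact: (linearB (linear_of L_linear)).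
have -> : L x *+ 2 - (Z x + L (L x)) = (L x - Y n.+1 x) *+ 2
   + ((Y n (Y n x) - L (Y n x)) + L (Y n x - L x)).
  rewrite LB mulrnBl [X in _ = _ + X]addrA subrK.
  have -> : Y n.+1 x *+ 2 = Z x + Y n (Y n x).
    by rewrite -scaler_nat /Y /= scalerA mulfV ?pnatr_eq0// scale1r.
  by rewrite !opprD !addrA subrK.
rewrite (_ : 8 * _ / _ = (2 * `|x| / n.+1%:R) *+ 2
  + (2 * `|x| / n.+1%:R + 2 * `|x| / n.+1%:R)); last by ring.
rewrite (le_trans (ler_normD _ _))// lerD//.
  rewrite normrMn lerMn2r distrC (le_trans (L_lim _ _))// ler_wpM2l ?mulr_ge0//.
  by rewrite lef_pV2 ?posrE ?ltr0n// ler_nat.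
rewrite (le_trans (ler_normD _ _))// lerD//.
  rewrite (le_trans (L_lim _ _))// ler_wpM2r ?invr_ge0// ler_wpM2l//.
  rewrite (le_trans (operator_iter_le _ _))// -[leRHS]mul1r ler_wpM2r//.
  exact: scalar_iter_le1.
by rewrite (le_trans (L_le _))// distrC.
Qed.

End SquareRoot.

(** With [M] a bound of [C], the contraction [Z = 1 - C / M] gives
   [(1 - Y) ^ 2 = C / M]. *)
Lemma positive_sqrt_exists (R : realType) (V : hilbertType R)
    (C : {linear V -> V}) :
  continuous C -> selfadjoint C -> nonnegative C ->
  exists P : {linear V -> V},
    [/\ continuous P, selfadjoint P, nonnegative P & forall x, P (P x) = C x].
Proof.
move=> /continuous_bounded[M M_gt0 C_le] C_sa C_ge0.
pose z x := x - M^-1 *: C x.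
have z_linear : linear z.
  move=> a x y; rewrite /z linearP scalerDr scalerBr scalerA mulrC -scalerA.
  by rewrite opprD addrACA.
have z_le x : `|z x| <= `|x|.
  rewrite -ler_sqr ?nnegrE// sqr_normB dotpZr normrZ exprMn dotpC.
  rewrite gtr0_norm ?invr_gt0// -addrA gerDl addrC subr_le0.
  rewrite expr2 -mulrA mulr2n -mulrDr ler_wpM2l ?invr_ge0 ?(ltW M_gt0)//.
  rewrite mulrC ler_pdivrMr//.
  rewrite (le_trans (nonneg_sqr_norm_le C_sa C_ge0 C_le x))//.
  by rewrite mulrC ler_wpM2r ?(ltW M_gt0)// lerDl.
have z_sa : selfadjoint (linear_of z_linear).
  by move=> x y /=; rewrite dotpBl dotpBr dotpZl dotpZr C_sa.
have [Y [Y_sa Y_le Y_fix]] := operator_iter_fixpoint z_sa z_le.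
pose p x := Num.sqrt M *: (x - Y x).
have p_linear : linear p.
  move=> a x y; rewrite /p linearP opprD addrACA -scalerBr scalerDr.
  by rewrite !scalerA mulrC.
exists (linear_of p_linear); split.
- apply: (@bounded_continuous _ _ _ _ (Num.sqrt M * 2)) => x /=.
  rewrite normrZ ger0_norm ?sqrtr_ge0// -mulrA ler_wpM2l ?sqrtr_ge0//.
  by rewrite (le_trans (ler_normB _ _))// mulrDl mul1r lerD2l.
- by move=> x y; rewrite /= dotpZl dotpZr dotpBl dotpBr Y_sa.
- move=> x; rewrite /= dotpZl mulr_ge0 ?sqrtr_ge0// dotpBl dotp_norm subr_ge0.
  rewrite (le_trans (ler_norm _))// (le_trans (cauchy_schwarz _ _))//.
  by rewrite expr2 ler_wpM2r.
- move=> x; rewrite /= /p.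
  have -> : Y (Num.sqrt M *: (x - Y x)) = Num.sqrt M *: (Y x - Y (Y x)).
    by rewrite linearZ linearB.
  rewrite -scalerBr scalerA -expr2 sqr_sqrtr ?(ltW M_gt0)//.
  have zE : z x = Y x *+ 2 - Y (Y x) by rewrite Y_fix addrK.
  have -> : x - Y x - (Y x - Y (Y x)) = M^-1 *: C x.
    rewrite (_ : M^-1 *: C x = x - z x); last by rewrite /z subKr.
    by rewrite zE mulr2n !opprB opprD !addrA; congr (_ - _); rewrite addrAC.
  by rewrite scalerA mulfV ?scale1r// gt_eqF.
Qed.

(** * Hilbert-Schmidt operators *)

Section HilbertSchmidt.
Context {R : realType}.
Local Open Scope ereal_scope.

(** Expand [L' f] in the basis [E] by Parseval, exchange the sums, and apply
   Bessel to [L e]. *)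
Lemma hilbert_schmidt_adjoint (V W : hilbertType R)
    (L : V -> W) (L' : W -> V) (E : set V) (F : set W) :
  adjoint_pair L L' -> orthonormal_basis E -> orthonormal_set F ->
  \esum_(f in F) (`|L' f| ^+ 2)%:E <= \esum_(e in E) (`|L e| ^+ 2)%:E.
Proof.
move=> LL bE oF.
apply: (@le_trans _ _ (\esum_(f in F) \esum_(e in E) (dotp (L' f) e ^+ 2)%:E)).
  by apply: le_esum => f _; exact: parseval_le.
have ge0 (f : W) (e : V) : F f -> E e -> 0 <= (dotp (L' f) e ^+ 2)%:E.
  by move=> _ _; rewrite lee_fin sqr_ge0.
rewrite esum_esum//.
rewrite (reindex_esum (E `*` F)%classic _ (fun p : V * W => (p.2, p.1))).
  rewrite -(@esum_esum R _ _ E (fun=> F) (fun e f => (dotp (L' f) e ^+ 2)%:E)).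
    apply: le_esum => e _; apply: le_trans (bessel (L e) oF).
    by apply: le_esum => f _; rewrite LL dotpC.
  by move=> e f Ee Ff; exact: ge0.
split=> [[e f] []//|[e f] [e' f'] _ _ [-> ->]//|[f e] [Ff Ee]].
by exists (e, f).
Qed.

Definition hilbert_schmidt (V W : hilbertType R) (L : V -> W) :=
  exists2 E : set V, orthonormal_basis E & \esum_(e in E) (`|L e| ^+ 2)%:E < +oo.

Lemma hilbert_schmidt_adj (V W : hilbertType R) (L : V -> W) (L' : W -> V) :
  adjoint_pair L L' -> hilbert_schmidt L -> hilbert_schmidt L'.
Proof.
move=> LL [E bE LE]; have [F bF] := @orthonormal_basis_exists R W.
exists F => //; apply: le_lt_trans LE.
exact: hilbert_schmidt_adjoint LL bE (orthonormal_basisW bF).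
Qed.

Lemma hilbert_schmidt_orthonormal (V W : hilbertType R) (L : V -> W)
    (L' : W -> V) (E : set V) :
  adjoint_pair L L' -> hilbert_schmidt L -> orthonormal_set E ->
  \esum_(e in E) (`|L e| ^+ 2)%:E < +oo.
Proof.
move=> LL /(hilbert_schmidt_adj LL)[F bF LF] oE; apply: le_lt_trans LF.
exact: hilbert_schmidt_adjoint (adjoint_pair_sym LL) bF oE.
Qed.

Lemma hilbert_schmidt_contraction (V W X : hilbertType R) (L : V -> W)
    (U : W -> X) :
  (forall x, `|U x| <= `|x|)%R -> hilbert_schmidt L -> hilbert_schmidt (U \o L).
Proof.
move=> U_le [E bE LE]; exists E => //; apply: le_lt_trans LE.
by apply: le_esum => e _; rewrite lee_fin ler_sqr ?nnegrE//=.
Qed.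

Lemma esum_dotp_lty (V W : hilbertType R) (L M : V -> W) (E : set V) :
  \esum_(e in E) (`|L e| ^+ 2)%:E < +oo ->
  \esum_(e in E) (`|M e| ^+ 2)%:E < +oo ->
  \esum_(e in E) (dotp (L e) (M e))%:E < +oo.
Proof.
move=> LE ME; apply: (@le_lt_trans _ _
  (\esum_(e in E) ((`|L e| ^+ 2)%:E + (`|M e| ^+ 2)%:E))).
  apply: le_esum => e _; rewrite -EFinD lee_fin.
  rewrite (le_trans (ler_norm _))// (le_trans (cauchy_schwarz _ _))//.
  have := sqr_ge0 (`|L e| - `|M e|)%R; have := sqr_ge0 (`|L e|)%R.
  have := sqr_ge0 (`|M e|)%R.
  by move: `|L e|%R `|M e|%R => a b; rewrite sqrrB mulr2n; lra.
rewrite esumD; first by rewrite lte_add_pinfty.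
all: by move=> e _; rewrite lee_fin sqr_ge0.
Qed.

End HilbertSchmidt.

(** * Trace class operators *)

Section TraceClass.
Context {R : realType}.

Lemma absolute_value_norm (V : hilbertType R) (T P : {linear V -> V}) :
  is_absolute_value T P -> forall x, `|P x| = `|T x|.
Proof.
move=> [_ P_sa _ [S TS PP]] x; apply/eqP.
by rewrite -(@eqrXn2 _ 2)// -!dotp_norm P_sa PP TS.
Qed.

Lemma absolute_value_exists (V : hilbertType R) (T : {linear V -> V}) :
  continuous T -> exists P, is_absolute_value T P.
Proof.
move=> /continuous_bounded[M M_gt0 T_le].
have [S TS] := adjoint_exists (ltW M_gt0) T_le.
have S_le := adjoint_pair_bound (ltW M_gt0) TS T_le.
have ST_cont : continuous (S \o T : {linear V -> V}).
  apply: (@bounded_continuous _ _ _ _ (M * M)) => x /=.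
  by rewrite (le_trans (S_le _))// -mulrA ler_pM2l.
have [||P [P_cont P_sa P_ge0 PP]] := positive_sqrt_exists ST_cont.
- by move=> x y /=; rewrite -TS (adjoint_pair_sym TS).
- by move=> x /=; rewrite (adjoint_pair_sym TS) dotp_norm sqr_ge0.
by exists P; split => //; exists S.
Qed.

(** Let [P] be the absolute value of [A].  Then [A = U P] and [P = S S] with [U]
   a contraction, so [dotp (A e) e = dotp (S e) (S (U' e))].  Here [S] is
   Hilbert-Schmidt because [P] has finite trace, and so is the adjoint [S U'] of
   [U S]. *)
Lemma trace_class_esum_lty (V : hilbertType R) (A : {linear V -> V}) :
  trace_class A ->
  exists2 E, orthonormal_basis E & (\esum_(e in E) (dotp (A e) e)%:E < +oo)%E.
Proof.
move=> [_ [P [E [absP bE PE]]]]; exists E => //.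
have [|U [U' [UU UP U_le]]] := @douglas _ _ _ _ P A.
  by move=> x; rewrite (absolute_value_norm absP).
have [P_cont P_sa P_ge0 _] := absP.
have [S [_ S_sa _ SS]] := positive_sqrt_exists P_cont P_sa P_ge0.
have SE : (\esum_(e in E) (`|S e| ^+ 2)%:E < +oo)%E.
  under eq_esum do rewrite -dotp_norm S_sa SS dotpC.
  exact: PE.
have S_hs : hilbert_schmidt S by exists E.
have US : adjoint_pair (U \o S) (S \o U') by exact: adjoint_pair_comp.
have US_hs := hilbert_schmidt_adj US (hilbert_schmidt_contraction U_le S_hs).
have SUE := hilbert_schmidt_orthonormal (adjoint_pair_sym US) US_hs
  (orthonormal_basisW bE).
have := esum_dotp_lty SE SUE.
by under eq_esum do rewrite /= -S_sa SS -UU UP.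
Qed.

(** The absolute value is [P = U L K] with [U] a contraction, so that
   [dotp (P e) e = dotp (K e) (L' (U' e))], where [L' U'] is the adjoint of the
   Hilbert-Schmidt operator [U L]. *)
Lemma trace_class_comp (V W : hilbertType R) (K : {linear W -> V})
    (L : {linear V -> W}) :
  continuous K -> continuous L -> hilbert_schmidt K -> hilbert_schmidt L ->
  trace_class (L \o K).
Proof.
move=> K_cont L_cont K_hs L_hs.
have LK_cont : continuous (L \o K).
  by move=> x; apply: continuous_comp; [exact: K_cont | exact: L_cont].
split=> //.
have [P absP] := absolute_value_exists LK_cont.
have [E bE] := @orthonormal_basis_exists R W; exists P, E; split => //.
have [|U [U' [UU UP U_le]]] := @douglas _ _ _ _ (L \o K) P.
  by move=> x; rewrite (absolute_value_norm absP).
have [M M_gt0 K_le] := continuous_bounded K_cont.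
have [K' KK] := adjoint_exists (ltW M_gt0) K_le.
have [N N_gt0 L_le] := continuous_bounded L_cont.
have [L' LL] := adjoint_exists (ltW N_gt0) L_le.
have oE := orthonormal_basisW bE.
have KE := hilbert_schmidt_orthonormal KK K_hs oE.
have UL : adjoint_pair (U \o L) (L' \o U') by exact: adjoint_pair_comp.
have UL_hs := hilbert_schmidt_adj UL (hilbert_schmidt_contraction U_le L_hs).
have LUE := hilbert_schmidt_orthonormal (adjoint_pair_sym UL) UL_hs oE.
have := esum_dotp_lty KE LUE.
by under eq_esum do rewrite /= -LL -UU -[L (K _)]/((L \o K) _) UP.
Qed.

End TraceClass.

(** * The symplectic map *)

Section SymplecticMap.
Context {R : realType} {H : hilbertType R}.

Lemma symplectic_map_linear : linear (@symplectic_map R H).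
Proof.
move=> a X Y; congr pair => /=; by rewrite opprD scalerN.
Qed.

Lemma symplectic_map_skew (X Y : hsum H H) :
  dotp (symplectic_map X) Y = - dotp X (symplectic_map Y).
Proof. by rewrite !hsum_dotpE /= dotpNl dotpNr; ring. Qed.

Lemma norm_symplectic_map (X : hsum H H) : `|symplectic_map X| = `|X|.
Proof.
apply/eqP; rewrite -(@eqrXn2 _ 2)// -!dotp_norm !hsum_dotpE /=.
by rewrite dotpNl dotpNr opprK addrC.
Qed.

End SymplecticMap.

Theorem proposition1p4 (R : realType) (H : hilbertType R)
    (A : {linear hsum H H -> hsum H H})
    (B : hilbertType R) (j : {linear quot_ker A -> B}) :
  separable H ->
  continuous A ->
  selfadjoint A -> nonnegative A -> trace_class A ->
  is_completion j ->
  exists T : {linear B -> B},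
    [/\ forall u : quot_ker A, T (j u) = j (quot_comp symplectic_map u),
        trace_class T &
        skew_symmetric T].
Proof.
move=> _ A_cont A_sa A_ge0 A_tr [j_dot _].
pose i : {linear hsum H H -> B} := j \o coset_ker A.
have i_dot X Y : dotp (i X) (i Y) = dotp (A X) Y.
  by rewrite j_dot quot_qformE.
have [M M_gt0 A_le] := continuous_bounded A_cont.
have i_le X : `|i X| <= Num.sqrt M * `|X|.
  rewrite -ler_sqr ?nnegrE ?mulr_ge0 ?sqrtr_ge0// exprMn sqr_sqrtr ?(ltW M_gt0)//.
  rewrite -dotp_norm i_dot (le_trans (ler_norm _))//.
  by rewrite (le_trans (cauchy_schwarz _ _))// expr2 mulrA ler_wpM2r.
have [i' ii] := adjoint_exists (sqrtr_ge0 M) i_le.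
have i'_le := adjoint_pair_bound (sqrtr_ge0 M) ii i_le.
have i'i X : i' (i X) = A X.
  by apply: dotp_inj => Y; rewrite (adjoint_pair_sym ii) i_dot.
have i_hs : hilbert_schmidt i.
  have [E bE AE] := trace_class_esum_lty A_tr; exists E => //.
  by under eq_esum do rewrite -dotp_norm i_dot.
pose F : {linear hsum H H -> hsum H H} := linear_of symplectic_map_linear.
have F_le X : `|F X| <= `|X| by rewrite norm_symplectic_map.
pose K : {linear B -> hsum H H} := F \o i'.
exists (i \o K); split.
- move=> u; rewrite -{1}(coset_kerK u) /= -[j (coset_ker A _)]/(i _) i'i.
  by rewrite -quot_compE coset_kerK.
- apply: trace_class_comp.
  + apply: (bounded_continuous (M := Num.sqrt M)) => x.
    exact: le_trans (F_le _) (i'_le x).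
  + exact: bounded_continuous i_le.
  + apply: (hilbert_schmidt_contraction F_le); exact: hilbert_schmidt_adj ii i_hs.
  + exact: i_hs.
- move=> x y; rewrite /= ii symplectic_map_skew.
  by rewrite (adjoint_pair_sym ii).
Qed.
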